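(* Let $V$ be a finite-dimensional real vector space endowed with a (continuous, linear) action of a compact group $G$ and with a $G$-invariant inner product $\langle\cdot,\cdot\rangle$. Let $v\in V$ be a vector whose orbit $\{gv : g\in G\}$ affinely spans $V$. Suppose that for some positive integer $k$ and some $\alpha_k>0$ every linear functional $l\in V^*$ satisfies $$\|l\|_\infty \le \alpha_k \|l\|_{2k}.$$ Let $W\subseteq V$ be a nonzero linear subspace of dimension $d_w$. Then $$\left(\frac{\mathrm{Vol}\, B^{\mathrm{o}}_W(v)}{\mathrm{Vol}\,\Sigma_W}\right)^{1/d_w} \ge \alpha_k^{-1}\sqrt{\frac{d_w}{2k\langle v,v\rangle}}.$$
   Context: For $l\in V^*$ put $$\|l\|_\infty=\max_{g\in G}|l(gv)|,\qquad \|l\|_{2k}=\left(\int_G l(gv)^{2k}\,d\mu(g)\right)^{1/2k},$$ where $\mu$ is the Haar probability measure on $G$. The dual body of the orbitope $\mathrm{conv}\{gv : g\in G\}$, viewed in $V$ via the inner product, is $$B^{\mathrm{o}}(v)=\{w\in V : \langle w,gv\rangle\le 1 \text{ for all } g\in G\}.$$ Its section by $W$ is $B^{\mathrm{o}}_W(v)=B^{\mathrm{o}}(v)\cap W$. $\Sigma_W=\{w\in W:\langle w,w\rangle\le 1\}$ is the unit ball of $W$. Volumes are $d_w$-dimensional Lebesgue volumes in $W$. *)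

(* Defs.v *)
From HB Require Import structures.
From mathcomp Require Import all_boot all_order all_algebra.
From mathcomp Require Import all_classical all_reals all_analysis.

Set Implicit Arguments.
Unset Strict Implicit.
Unset Printing Implicit Defensive.

Import Order.TTheory GRing.Theory Num.Theory.
Import numFieldNormedType.Exports.

Local Open Scope classical_set_scope.
Local Open Scope ring_scope.

(* The base point only serves to make G eligible for g_sigma_algebraType. *)
HB.mixin Record isTopologicalGroup G & Group G & PointedTopological G := {
  mulg_continuous : continuous (fun p : G * G => (p.1 * p.2)%g) ;
  invg_continuous : continuous (fun g : G => (g^-1)%g)
}.

#[short(type="topologicalGroupType")]
HB.structure Definition TopologicalGroup :=
  {G of Group G & PointedTopological G & isTopologicalGroup G}.

Notation borel T := (g_sigma_algebraType (@open T)).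

(* Regular left-invariant Borel probability. "closed" in the inner regularity
   clause is redundant when G is Hausdorff; in general it makes K Borel. *)
Record haar_probability (R : realType) (G : topologicalGroupType)
    (mu : probability (borel G) R) : Prop := {
  haar_left_invariant : forall (g : G) (A : set (borel G)), measurable A ->
    mu [set (g * x)%g | x in (A : set G)] = mu A ;
  haar_outer_regular : forall A : set (borel G), measurable A ->
    mu A = ereal_inf [set mu U | U in [set U : set G | open U /\ A `<=` U]] ;
  haar_inner_regular : forall U : set G, open U ->
    mu U = ereal_sup
      [set mu K | K in [set K : set G | [/\ compact K, closed K & K `<=` U]]]
}.

Section InnerProduct.
Variables (R : realType) (V : vectType R) (ip : {dot V for idfun}).

Definition ipnorm (x : V) : R := Num.sqrt (ip x x).

Definition orthonormal_system n (b : n.-tuple V) : Prop :=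
  forall i j, ip (tnth b i) (tnth b j) = (i == j)%:R.

Let ipC (x y : V) : ip x y = ip y x.
Proof. by rewrite hermC expr0 mul1r. Qed.

Let free_orthonormal n (b : n.-tuple V) : orthonormal_system b -> free b.
Proof.
move=> bo; apply/freeP => c c0 i.
have := congr1 (ip (tnth b i)) c0.
rewrite linear0r linear_sumr (bigD1 i)//= big1 => [|j ji]; last first.
  by rewrite -(tnth_nth 0 b j) linearZr_LR /= bo eq_sym (negbTE ji) mulr0.
by rewrite -(tnth_nth 0 b i) linearZr_LR /= bo eqxx mulr1 addr0.
Qed.

Lemma exists_orthonormal_basis (W : {vspace V}) :
  exists b : (\dim W).-tuple V, basis_of W b /\ orthonormal_system b.
Proof.
suff H n : (n <= \dim W)%N -> exists b : n.-tuple V,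
    {subset b <= W} /\ orthonormal_system b.
  have [b [bW bo]] := H _ (leqnn _).
  exists b; split => //.
  by rewrite basisEfree free_orthonormal// size_tuple leqnn andbT; exact/span_subvP.
elim: n => [_|n IH nW].
  by exists [tuple]; split => [//|[]].
have [b [bW bo]] := IH (ltnW nW).
have /subvPn[w wW wb] : ~~ (W <= <<b>>)%VS.
  apply/negP => /dimvS; rewrite leqNgt => /negP; apply.
  by rewrite (leq_ltn_trans (dim_span _))// size_tuple.
pose u := w - \sum_i ip (tnth b i) w *: tnth b i.
have uW : u \in W.
  by rewrite rpredB// rpred_sum// => i _; rewrite rpredZ// bW// mem_tnth.
have u0 : u != 0.
  apply: contra wb; rewrite subr_eq0 => /eqP ->.
  by rewrite rpred_sum// => i _; rewrite rpredZ// memv_span// mem_tnth.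
have uu : 0 < ip u u by exact: neq0_dnorm_gt0.
have bu i : ip (tnth b i) u = 0.
  rewrite linearBr linear_sumr (bigD1 i)//= big1 => [|j ji]; last first.
    by rewrite linearZr_LR /= bo eq_sym (negbTE ji) mulr0.
  by rewrite linearZr_LR /= bo eqxx mulr1 addr0 subrr.
pose e := (ipnorm u)^-1 *: u.
have be i : ip (tnth b i) e = 0 by rewrite linearZr_LR /= bu mulr0.
have ee : ip e e = 1.
  rewrite linearZl_LR linearZr_LR /= mulrA -expr2 exprVn sqr_sqrtr ?ltW//.
  by rewrite mulVf ?gt_eqF.
exists [tuple of e :: b]; split => [x|i j].
  by rewrite inE => /predU1P[->|/bW//]; rewrite rpredZ.
case: (unliftP ord0 i) => [i'|] ->; case: (unliftP ord0 j) => [j'|] ->;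
  by rewrite ?tnth0 ?tnthS ?ee ?be ?(ipC e) ?be ?eqxx//.
Qed.

Definition orthonormal_basis (W : {vspace V}) : (\dim W).-tuple V :=
  sval (cid (exists_orthonormal_basis W)).

End InnerProduct.

(* Product Lebesgue measure of a Borel subset of R^n, as an iterated integral
   over slices. *)
Fixpoint lebesgue_tuple (R : realType) (n : nat) :
    set (n.-tuple R) -> \bar R :=
  match n with
  | 0%N => fun A => \d_([tuple] : 0.-tuple R) A
  | n'.+1 => fun A => (\int[lebesgue_measure]_(x in [set: R])
      lebesgue_tuple [set t : n'.-tuple R | A [tuple of x :: t]])%E
  end.

(* Lebesgue volume in W, transported from R^(dim W) by the coordinates in an
   orthonormal basis of W (the value does not depend on which one). *)
Definition vol (R : realType) (V : vectType R) (ip : {dot V for idfun})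
    (W : {vspace V}) (A : set V) : \bar R :=
  lebesgue_tuple [set c : (\dim W).-tuple R |
    A (\sum_i tnth c i *: tnth (orthonormal_basis ip W) i)].

(* Continuity of G x V -> V is joint continuity for the norm of ip, which
   induces the standard topology of the finite-dimensional space V. *)
Record continuous_linear_action (R : realType) (G : topologicalGroupType)
    (V : vectType R) (ip : {dot V for idfun}) (rho : G -> 'End(V)) : Prop := {
  action1 : forall x, rho 1%g x = x ;
  actionM : forall (g h : G) x, rho (g * h)%g x = rho g (rho h x) ;
  action_continuous : forall (g0 : G) (x0 : V) (e : R), 0 < e ->
    exists2 d : R, 0 < d & \forall g \near g0,
      forall x, ipnorm ip (x - x0) < d -> ipnorm ip (rho g x - rho g0 x0) < e
}.

Section Orbitope.
Variables (R : realType) (G : topologicalGroupType) (V : vectType R).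
Variables (ip : {dot V for idfun}) (rho : G -> 'End(V)).

Definition invariant_ip : Prop :=
  forall g x y, ip (rho g x) (rho g y) = ip x y.

Definition group_orbit (v : V) : set V := [set rho g v | g in [set: G]].

Definition affine_hull (S : set V) : set V :=
  [set x | exists n (p : 'I_n -> V) (a : 'I_n -> R),
     [/\ forall i, S (p i), \sum_i a i = 1 & x = \sum_i a i *: p i]].

(* A maximum for compact G and continuous rho, since g |-> l (rho g v) is then
   continuous. *)
Definition normoo (v : V) (l : {scalar V}) : R :=
  sup [set `|l (rho g v)| | g in [set: G]].

Definition norm2k (mu : probability (borel G) R) (k : nat) (v : V)
    (l : {scalar V}) : R :=
  (\int[mu]_(g in [set: borel G]) (l (rho g v) ^+ (2 * k))) `^ (2 * k)%:R^-1.

Definition dual_body (v : V) : set V :=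
  [set w | forall g, ip w (rho g v) <= 1].

Definition dual_body_section (W : {vspace V}) (v : V) : set V :=
  dual_body v `&` [set w | w \in W].

Definition unit_ball (W : {vspace V}) : set V :=
  [set w | w \in W /\ ip w w <= 1].

End Orbitope.

(* Main.v *)
From HB Require Import structures.
Require Import Defs.
From mathcomp Require Import all_boot all_order all_algebra.
From mathcomp Require Import all_classical all_reals all_analysis.
From mathcomp Require Import measurable_realfun simple_functions.
From mathcomp Require Import ring lra.

Import Order.TTheory GRing.Theory Num.Theory.
Import numFieldNormedType.Exports.

Set Implicit Arguments.
Unset Strict Implicit.
Unset Printing Implicit Defensive.

Local Open Scope classical_set_scope.
Local Open Scope ring_scope.

(** Write n for the dimension of W. In orthonormal coordinates c on W put
    F(c) = alpha^(2k) * int_G <c, gv>^(2k) dg. The hypothesis on the norms says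
    that <c, gv> <= F(c)^(1/2k) for all g, so the section of the dual body
    contains K = {F <= 1}, and it suffices to show that K has at least the
    volume of the ball B = {|c|^2 <= r}, where r = n / (2k * alpha^2 * <v,v>)
    ([lebn_sq_ball_le_avg_pow]).

    Suppose that K has smaller volume than B. Let H(c) = (|c|^2 / r)^k; its
    sublevel sets are balls, and B = {H <= 1}. Both F and H are homogeneous of
    degree 2k, so by scaling every {F <= s} with s > 0 has smaller volume than
    {H <= s}. The Gaussian weight exp(-|c|^2/2) is radially decreasing, hence a
    ball carries at least as much of its mass as any set of no larger volume
    ([bathtub]), and integrating over the levels s ([le_layer_cake]) gives that
    the Gaussian integral of H is at most that of F.

    Both integrals are estimated. Normalise by the total Gaussian mass. A
    Bernoulli inequality bounds the integral of |c|^(2k) below by (9n/10)^k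
    ([gauss_moment_ge]), so that of H is at least (9/10)^k * (n/r)^k. For the
    upper bound, <c, u>^(2k) is dominated by exponentials of <c, u>, whose
    Gaussian integrals factor over the coordinates; this gives at most
    2 * exp(-k) * (2k * |u|^2)^k ([gauss_moment_le]), and Bessel's inequality
    with the invariance of the inner product bounds |u|^2 by
    alpha^2 * <v,v> for the coordinate vector u of alpha * gv. So F integrates
    to at most 2 * exp(-k) * (n/r)^k, and (9/10)^k <= 2 * exp(-k) would follow,
    which is false because 9e/10 > 2.

    This replaces polar coordinates and rotation invariance by homogeneity and
    the product structure of the Gaussian, both of which suit a Lebesgue
    measure given by iterated integration. *)

(** * Lebesgue measure on tuples *)

Definition tcons (R : realType) n
    (p : measurableTypeR R * n.-tuple (measurableTypeR R)) :
  n.+1.-tuple (measurableTypeR R) := [tuple of p.1 :: p.2].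

Lemma measurable_tcons (R : realType) n : measurable_fun setT (@tcons R n).
Proof. exact: measurable_cons. Qed.

Section TupleMeasure.
Context {R : realType}.
Implicit Types n : nat.
Local Notation GR := (measurableTypeR R).

Definition tuncons n (t : n.+1.-tuple GR) : GR * n.-tuple GR :=
  (thead t, [tuple of behead t]).

Lemma tconsK n : cancel (@tcons R n) (@tuncons n).
Proof. by case=> x t; rewrite /tuncons/=; congr (_, _); apply: val_inj. Qed.

Lemma measurable_tuncons n : measurable_fun [set: n.+1.-tuple GR] (@tuncons n).
Proof.
apply: measurable_fun_pair; last exact: measurable_behead.
exact: (@measurable_tnth _ _ n.+1 ord0).
Qed.

Section Step.
Variables (n : nat) (m : {sigma_finite_measure set (n.-tuple GR) -> \bar R}).

(** One step of the product construction, carried to tuples so that iterating it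
    matches the slices in [lebesgue_tuple]. *)
Definition cons_measure : set (n.+1.-tuple GR) -> \bar R :=
  pushforward (@lebesgue_measure R \x m)%E (@tcons R n).

Let pf : {measure set (n.+1.-tuple GR) -> \bar R} :=
  measure_function_pushforward__canonical__measure_function_Measure
    (@lebesgue_measure R \x m)%E (@measurable_tcons R n).

HB.instance Definition _ := isMeasure.Build _ _ _ cons_measure
  (measure0 pf) (measure_ge0 pf) (@measure_semi_sigma_additive _ _ _ pf).

(** Tonelli's theorem at the next dimension needs sigma-finiteness; products of
    two exhausting sequences exhaust the product. *)
Let cons_measure_sigma_finite : sigma_finite [set: n.+1.-tuple GR] cons_measure.
Proof.
have /sigma_finiteP[F [FT ndF Foo]] := sigma_finiteT (@lebesgue_measure R).
have /sigma_finiteP[H [HT ndH Hoo]] := sigma_finiteT m.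
exists (fun i => @tuncons n @^-1` (F i `*` H i)).
  rewrite -preimage_bigcup (_ : \bigcup_i _ = setT) ?preimage_setT//.
  rewrite -subTset => -[x y] _.
  have [i _ Fx] : (\bigcup_i F i) x by rewrite -FT.
  have [j _ Hy] : (\bigcup_i H i) y by rewrite -HT.
  exists (maxn i j) => //; split => /=.
    by move: x Fx; exact/subsetPset/ndF/leq_maxl.
  by move: y Hy; exact/subsetPset/ndH/leq_maxr.
move=> i; have [mF Fi] := Foo i; have [mH Hi] := Hoo i; split.
  rewrite -[X in measurable X]setTI; apply: measurable_tuncons => //.
  exact: measurableX.
rewrite /cons_measure /pushforward -comp_preimage (_ : _ \o _ = id).
  by rewrite preimage_id product_measure1E// lte_mul_pinfty// ge0_fin_numE.
by apply/funext => p /=; rewrite tconsK.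
Qed.
HB.instance Definition _ := @Measure_isSigmaFinite.Build _ _ _
  cons_measure cons_measure_sigma_finite.
End Step.

(** [lebesgue_tuple] is only a set function; [lebn] is the bundled measure with
    the same values on measurable sets ([lebesgue_tupleE]), to which integration
    theory applies. *)
Fixpoint lebn n : {sigma_finite_measure set (n.-tuple GR) -> \bar R} :=
  match n with
  | 0%N => dirac ([tuple] : 0.-tuple GR)
  | n'.+1 => cons_measure (lebn n')
  end.

Lemma ge0_integral_cons n (f : n.+1.-tuple GR -> \bar R) :
  measurable_fun [set: n.+1.-tuple GR] f -> (forall t, 0 <= f t)%E ->
  (\int[lebn n.+1]_t f t =
   \int[lebesgue_measure]_x \int[lebn n]_t f (tcons (x, t)))%E.
Proof.
move=> mf f0.
rewrite [LHS](@ge0_integral_pushforward _ _ _ _ _ _ (@measurable_tcons R n))//.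
rewrite preimage_setT fubini_tonelli1//.
- apply: measurableT_comp => //; exact: measurable_tcons.
- by move=> p /=.
Qed.

Lemma measurable_cons_slice n (x : GR) :
  measurable_fun [set: n.-tuple GR] (fun t => tcons (x, t)).
Proof.
apply: (measurableT_comp (@measurable_tcons R n)); exact: pair1_measurable.
Qed.

Lemma lebesgue_tupleE n (A : set (n.-tuple GR)) : measurable A ->
  lebesgue_tuple A = lebn n A.
Proof.
elim: n A => [//|n IH] A mA.
rewrite [RHS]/= /cons_measure /pushforward /product_measure1 [LHS]/=.
apply: eq_integral => x _ /=.
have -> : xsection (@tcons R n @^-1` A) x = (fun t => tcons (x, t)) @^-1` A.
  by apply/seteqP; split => t; rewrite /xsection /= inE.
rewrite -IH//.
rewrite -[X in measurable X]setTI; exact: measurable_cons_slice.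
Qed.

Lemma lebesgue_tuple_ge0 n (A : set (n.-tuple R)) : (0 <= lebesgue_tuple A)%E.
Proof. by elim: n A => [A|n IH A] //=; exact: integral_ge0. Qed.

(** The integral of a nonnegative function is a supremum over simple functions
    below it, so it is monotone even for non-measurable functions. This makes
    [lebesgue_tuple] monotone on arbitrary sets, and spares proving that the
    section of the dual body is measurable. *)
Lemma ge0_le_integral_all d (T : measurableType d) (m : {measure set T -> \bar R})
    (f g : T -> \bar R) : (forall x, 0 <= f x)%E -> (forall x, f x <= g x)%E ->
  (\int[m]_x f x <= \int[m]_x g x)%E.
Proof.
move=> f0 fg; have g0 x : (0 <= g x)%E := le_trans (f0 x) (fg x).
rewrite !ge0_integralTE//; apply: ge_ereal_sup => _ [h hf <-].
apply: ereal_sup_ubound; exists h => // x.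
exact: le_trans (hf x) (fg x).
Qed.

Lemma le_lebesgue_tuple n (A B : set (n.-tuple R)) : A `<=` B ->
  (lebesgue_tuple A <= lebesgue_tuple B)%E.
Proof.
elim: n A B => [|n IH] A B AB /=.
  by rewrite /dirac lee_fin !indicE; case: (boolP (_ \in A)) => // /set_mem/AB/mem_set->.
apply: ge0_le_integral_all => x; first exact: lebesgue_tuple_ge0.
by apply: IH => t /=; exact: AB.
Qed.

Lemma measurable_scale1 (s : R) : measurable_fun [set: GR] (fun x : GR => s * x : GR).
Proof. exact: (@measurable_funM _ _ _ _ (cst s) id). Qed.

(** Both sides are measures in A that agree on half-open intervals. *)
Lemma lebesgue_measure_scale (s : R) (A : set GR) : 0 < s -> measurable A ->
  lebesgue_measure [set x : GR | A (s * x)] = ((s^-1)%:E * lebesgue_measure A)%E.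
Proof.
move=> s0 mA.
have ms := measurable_scale1 s.
pose sc : {measure set GR -> \bar R} :=
  measure_function_pushforward__canonical__measure_function_Measure lebesgue_measure ms.
pose nu : {measure set GR -> \bar R} := mscale (NngNum (ltW s0)) sc.
suff -> : lebesgue_measure A = nu A.
  by rewrite /nu /= /mscale /= muleA -EFinM mulVf ?gt_eqF// mul1e.
apply: lebesgue_measure_unique mA => /= _ [[a b]] _ <-.
rewrite /nu /= /mscale /=.
have -> : pushforward lebesgue_measure (fun x : GR => s * x : GR) `]a, b] =
    lebesgue_measure `]a/s, b/s]%classic.
  congr lebesgue_measure; apply/seteqP; split => x /=;
    by rewrite !in_itv/= ltr_pdivrMr// ler_pdivlMr// [x * s]mulrC.
have L (c d : R) : lebesgue_measure (`]c, d]%classic : set GR) =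
    (if (c < d)%R then (d - c)%:E else 0)%E.
  by rewrite lebesgue_measure_itv/= lte_fin EFinB.
rewrite !L ltr_pM2r ?invr_gt0//; case: ifP => _; last by rewrite mule0.
by rewrite -EFinM -mulrBl mulrCA divff ?gt_eqF// mulr1.
Qed.

Lemma ge0_integral_scale (s : R) (f : GR -> \bar R) : 0 < s ->
  measurable_fun [set: GR] f -> (forall x, 0 <= f x)%E ->
  (\int[lebesgue_measure]_(x in [set: GR]) f (s * x)%R =
   (s^-1)%:E * \int[lebesgue_measure]_x f x)%E.
Proof.
move=> s0 mf f0.
have ms := measurable_scale1 s.
have si0 : 0 <= s^-1 by rewrite invr_ge0 ltW.
rewrite -(ge0_integral_mscale _ _ (NngNum si0))//.
rewrite -[LHS](@ge0_integral_pushforward _ _ GR GR R _ ms lebesgue_measure setT f)//.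
apply: eq_measure_integral => /= A mA _.
by rewrite /mscale /= -lebesgue_measure_scale.
Qed.

Definition scale_tuple n (s : R) (t : n.-tuple GR) : n.-tuple GR :=
  [tuple s * tnth t i | i < n].

Lemma measurable_scale_tuple n (s : R) :
  measurable_fun [set: n.-tuple GR] (scale_tuple s).
Proof.
apply/measurable_fun_tnthP => i /=.
rewrite (_ : _ \o _ = fun t : n.-tuple GR => s * tnth t i : GR); last first.
  by apply/funext => t /=; rewrite tnth_mktuple.
apply: (@measurable_funM _ _ _ _ (cst s)) => //.
exact: (@measurable_tnth _ GR n i).
Qed.

Lemma scale_tuple_cons n s x (t : n.-tuple GR) :
  scale_tuple s (tcons (x, t)) = tcons (s * x, scale_tuple s t).
Proof.
apply: eq_from_tnth => i; rewrite tnth_mktuple.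
by case: (unliftP ord0 i) => [j|] ->; rewrite ?tnth0 ?tnthS ?tnth_mktuple.
Qed.

(** Induction on n: scale the slices, then the first coordinate. *)
Lemma lebn_scale n (s : R) (A : set (n.-tuple GR)) : 0 < s -> measurable A ->
  lebn n [set t | A (scale_tuple s t)] = ((s ^- n)%:E * lebn n A)%E.
Proof.
move=> s0; elim: n A => [|n IH] A mA.
  rewrite expr0 invr1 mul1e; congr (lebn 0 _).
  by apply/seteqP; split => t /=; rewrite [scale_tuple _ _]tuple0 [t]tuple0.
rewrite -!lebesgue_tupleE//; last first.
  by rewrite -[X in measurable X]setTI; exact: measurable_scale_tuple.
have mS x : measurable ((fun t => tcons (x, t)) @^-1` A).
  by rewrite -[X in measurable X]setTI; exact: measurable_cons_slice.
have mL : measurable_fun [set: GR] (fun x => lebn n ((fun t => tcons (x, t)) @^-1` A)).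
  have mA' : measurable (@tcons R n @^-1` A).
    by rewrite -[X in measurable X]setTI; exact: measurable_tcons.
  apply: eq_measurable_fun (measurable_fun_xsection (lebn n) mA') => x _ /=.
  congr (lebn n _); apply/seteqP; split => t; by rewrite /xsection /= inE.
rewrite /=.
transitivity (\int[lebesgue_measure]_(x in [set: GR])
    ((s ^- n)%:E * lebn n ((fun t => tcons ((s * x)%R, t)) @^-1` A)))%E.
  apply: eq_integral => x _.
  rewrite -IH// -lebesgue_tupleE; last first.
    rewrite -[X in measurable X]setTI.
    exact: (measurable_scale_tuple s measurableT (mS _)).
  by congr lebesgue_tuple; apply/seteqP; split => t /=; rewrite -scale_tuple_cons.
rewrite ge0_integralZl//.
- rewrite (@ge0_integral_scale s (fun x => lebn n ((fun t => tcons (x, t)) @^-1` A)))//.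
  rewrite muleA -EFinM exprS invfM mulrC; congr (_ * _)%E.
  by apply: eq_integral => x _; rewrite -lebesgue_tupleE.
- apply: (measurableT_comp mL); exact: measurable_scale1.
- by rewrite lee_fin invr_ge0 exprn_ge0// ltW.
Qed.

End TupleMeasure.

(** * Gaussian integrals *)

Section Gaussian.
Context {R : realType}.
Implicit Types n : nat.
Local Notation GR := (measurableTypeR R).

Definition tdot n (u t : n.-tuple R) : R := \sum_i tnth u i * tnth t i.
Definition tsq n (t : n.-tuple R) : R := \sum_i tnth t i ^+ 2.

Lemma measurable_coord n (i : 'I_n) :
  measurable_fun [set: n.-tuple GR] (fun t => tnth t i : R).
Proof. exact: (@measurable_tnth _ GR n i). Qed.

Lemma measurable_tdot n (u : n.-tuple R) :
  measurable_fun [set: n.-tuple GR] (fun t => tdot u t).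
Proof.
apply: measurable_sum => i; apply: (@measurable_funM _ _ _ _ (cst (tnth u i))) => //.
exact: measurable_coord.
Qed.

Lemma measurable_tsq n : measurable_fun [set: n.-tuple GR] (@tsq n).
Proof.
by apply: measurable_sum => i; apply: measurable_funX; exact: measurable_coord.
Qed.

Lemma tsq_ge0 n (t : n.-tuple R) : 0 <= tsq t.
Proof. by apply: sumr_ge0 => i _; exact: sqr_ge0. Qed.

Lemma tdot_cons n (a : R) (u : n.-tuple R) x (t : n.-tuple R) :
  tdot (tcons (a, u)) (tcons (x, t)) = a * x + tdot u t.
Proof.
rewrite /tdot big_ord_recl !tnth0; congr (_ + _).
by apply: eq_bigr => i _; rewrite !tnthS.
Qed.

Lemma tsq_cons n x (t : n.-tuple R) : tsq (tcons (x, t)) = x ^+ 2 + tsq t.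
Proof.
by rewrite /tsq big_ord_recl tnth0; congr (_ + _); apply: eq_bigr => i _; rewrite tnthS.
Qed.

Definition sqrt2pi : R := Num.sqrt (pi *+ 2).

Lemma sqrt2pi_gt0 : 0 < sqrt2pi.
Proof. by rewrite sqrtr_gt0 mulrn_wgt0// pi_gt0. Qed.

(** Completing the square turns the integrand into a multiple of the normal
    density of mean a / q^2 and standard deviation 1 / q. *)
Lemma integral_exp_quadratic1 (a q : R) : 0 < q ->
  (\int[lebesgue_measure]_(x in [set: GR]) (expR (a * x - q ^+ 2 * x ^+ 2 / 2))%:E =
   (sqrt2pi / q * expR (a ^+ 2 / (q ^+ 2 * 2)))%:E)%E.
Proof.
move=> q0; have q00 : q != 0 by rewrite gt_eqF.
have s0 : q^-1 != 0 by rewrite invr_eq0.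
set C := sqrt2pi / q * _.
have C0 : 0 <= C by rewrite !mulr_ge0 ?expR_ge0 ?invr_ge0 ?ltW// sqrt2pi_gt0.
rewrite -[RHS]mule1 -(integral_normal_pdf (a / q ^+ 2) q^-1) -ge0_integralZl//;
  last 2 first.
- by apply/measurable_EFinP; exact: measurable_normal_pdf.
- by move=> x _; rewrite lee_fin normal_pdf_ge0.
- apply: eq_integral => x _; rewrite -EFinM; congr (_%:E).
  rewrite normal_pdfE// /normal_peak /normal_fun.
  have -> : Num.sqrt (q^-1 ^+ 2 * pi *+ 2) = sqrt2pi / q.
    by rewrite -mulrnAr sqrtrM ?sqr_ge0// sqrtr_sqr ger0_norm ?invr_ge0 ?ltW// mulrC.
  rewrite /C.
  rewrite [RHS]mulrACA divff ?mul1r; last first.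
    by rewrite mulf_neq0 ?invr_eq0// gt_eqF// sqrt2pi_gt0.
  by rewrite -expRD; congr expR; field.
Qed.

(** The integrand is a product over the coordinates, so the slice integrals
    separate. The linear term serves for the upper moment bound, the parameter q
    for the lower one. *)
Lemma integral_exp_quadratic n (u : n.-tuple R) (q : R) : 0 < q ->
  (\int[lebn n]_t (expR (tdot u t - q ^+ 2 * tsq t / 2))%:E =
   ((sqrt2pi / q) ^+ n * expR (tsq u / (q ^+ 2 * 2)))%:E)%E.
Proof.
move=> q0.
have mg m (w : m.-tuple R) : measurable_fun [set: m.-tuple GR]
    (fun t => (expR (tdot w t - q ^+ 2 * tsq t / 2))%:E).
  apply/measurable_EFinP; apply: measurableT_comp => //.
  apply: measurable_funB; first exact: measurable_tdot.
  apply: measurable_funM => //; apply: measurable_funM => //; exact: measurable_tsq.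
elim: n u => [|n IH] u.
  rewrite integral_dirac; [|exact: measurableT|exact: mg].
  rewrite diracE mem_set// mul1e expr0 mul1r; congr (expR _)%:E.
  by rewrite /tdot /tsq !big_ord0 mulr0 !mul0r subr0.
rewrite ge0_integral_cons; [|exact: mg|by move=> t; rewrite lee_fin expR_ge0].
case/tupleP: u => a u; rewrite -[cons_tuple a u]/(tcons (a, u)).
set C := (sqrt2pi / q) ^+ n * expR (tsq u / (q ^+ 2 * 2)).
have C0 : 0 <= C.
  by rewrite mulr_ge0 ?expR_ge0// exprn_ge0 ?mulr_ge0 ?invr_ge0// ltW// sqrt2pi_gt0.
transitivity (\int[lebesgue_measure]_(x in [set: GR])
   (C%:E * (expR (a * x - q ^+ 2 * x ^+ 2 / 2))%:E))%E.
  apply: eq_integral => x _; rewrite muleC -IH.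
  rewrite -ge0_integralZl;
    [|exact: measurableT|exact: mg|by move=> t _; rewrite lee_fin expR_ge0|
     by rewrite lee_fin expR_ge0].
  apply: eq_integral => t _; rewrite -EFinM -expRD; congr (expR _)%:E.
  by rewrite tdot_cons tsq_cons; ring.
rewrite ge0_integralZl//; last first.
  apply/measurable_EFinP; apply: measurableT_comp => //.
  by apply: measurable_funB; apply: measurable_funM => //;
    apply: measurable_funM => //; exact: measurable_funX.
rewrite integral_exp_quadratic1// -EFinM; congr (_%:E).
rewrite tsq_cons mulrDl expRD /C [_ ^+ n.+1]exprS; ring.
Qed.

Definition gauss n (t : n.-tuple R) : R := expR (- tsq t / 2).

Lemma gauss_gt0 n (t : n.-tuple R) : 0 < gauss t. Proof. exact: expR_gt0. Qed.
Lemma gauss_ge0 n (t : n.-tuple R) : 0 <= gauss t. Proof. exact: expR_ge0. Qed.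

Lemma measurable_gauss n : measurable_fun [set: n.-tuple GR] (@gauss n).
Proof.
apply: measurableT_comp => //; apply: measurable_funM => //.
apply: measurableT_comp => //; exact: measurable_tsq.
Qed.

Lemma integral_gauss n : (\int[lebn n]_t (gauss t)%:E = (sqrt2pi ^+ n)%:E)%E.
Proof.
have := @integral_exp_quadratic n [tuple 0 | i < n] 1 ltr01.
rewrite divr1 => h; rewrite (_ : sqrt2pi ^+ n =
    sqrt2pi ^+ n * expR (tsq [tuple (0:R) | i < n] / (1 ^+ 2 * 2))).
  rewrite -h; apply: eq_integral => t _; congr (expR _)%:E.
  rewrite /tdot big1 ?sub0r ?expr1n ?mul1r ?mulNr// => i _.
  by rewrite tnth_mktuple mul0r.
by rewrite /tsq big1 ?mul0r ?expR0 ?mulr1// => i _; rewrite tnth_mktuple expr0n.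
Qed.

End Gaussian.

(** * Moments of the Gaussian *)

Section Moments.
Context {R : realType}.
Implicit Types n k : nat.
Local Notation GR := (measurableTypeR R).

Lemma bernoulli_ge (x : R) n : -1 <= x -> 1 + n%:R * x <= (1 + x) ^+ n.
Proof.
move=> x1; elim: n => [|n IH]; first by rewrite mul0r addr0 expr0.
have h : 0 <= 1 + x by lra.
rewrite exprS; apply: le_trans (ler_wpM2l h IH).
have := ler0n R n; have := sqr_ge0 x; rewrite -natr1 => *; nra.
Qed.

(** The graph of y^(k+1) lies above its tangent at m. *)
Lemma tangent_pow (y m : R) k : 0 <= y -> 0 < m ->
  k.+1%:R * m ^+ k * y <= y ^+ k.+1 + k%:R * m ^+ k.+1.
Proof.
move=> y0 m0.
have h : -1 <= y / m - 1 by rewrite lerBrDr addNr divr_ge0// ltW.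
have := bernoulli_ge k.+1 h.
rewrite addrCA subrr addr0 expr_div_n ler_pdivlMr ?exprn_gt0// => H.
rewrite -subr_ge0; move: H; rewrite -subr_ge0; congr (_ <= _).
rewrite !exprS -natr1; field; rewrite gt_eqF//.
Qed.

(** The mean of |c|^2 is n, but 9n/10 is enough. Since
    y >= 2/(q^2-1) * (1 - exp(-(q^2-1)y/2)), it is bounded below by Gaussian
    integrals alone, with an error that vanishes as q tends to 1; q = 1 + 1/(20n)
    is close enough in dimension n. *)
Lemma gauss_scale_bound n : (0 < n)%N ->
  exists q : R, 1 < q /\
    9/10 * n%:R <= 2 / (q ^+ 2 - 1) * (1 - q ^- n).
Proof.
move=> n0; have nR : 1 <= n%:R :> R by rewrite ler1n.
have n00 : n%:R != 0 :> R by rewrite pnatr_eq0 -lt0n.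
pose d : R := (20 * n%:R)^-1.
have d0 : 0 < d by rewrite invr_gt0; lra.
have nd : n%:R * d = 1/20 by rewrite /d; field.
exists (1 + d); split; first by lra.
have B : 21/20 <= (1 + d) ^+ n.
  by apply: le_trans (bernoulli_ge n _); [rewrite nd; lra|lra].
have I : (1 + d) ^- n <= 20/21.
  rewrite (_ : 20/21 = (21/20)^-1); last by field.
  by rewrite lef_pV2// posrE; lra.
have -> : (1 + d) ^+ 2 - 1 = d * (2 + d) by ring.
rewrite [leRHS]mulrAC ler_pdivlMr; last by rewrite mulr_gt0//; lra.
have -> : 9 / 10 * n%:R * (d * (2 + d)) = 9 / 10 * (n%:R * d) * (2 + d) by field.
rewrite nd.
have d1 : d <= 1/20 by nra.
nra.
Qed.

(** This is e * z <= exp z at z = s|x|/(2k), raised to the power 2k; the two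
    exponentials on the right dominate exp (s|x|). *)
Lemma pow_exp_bound (x s : R) k : (0 < k)%N -> 0 < s ->
  x ^+ (2 * k) * (s ^+ (2 * k) * expR 1 ^+ (2 * k)) <=
  (2 * k)%:R ^+ (2 * k) * (expR (s * x) + expR (- s * x)).
Proof.
move=> k0 s0; set m := (2 * k)%N.
have m0 : (0 < m)%N by rewrite muln_gt0.
have mR : 0 < m%:R :> R by rewrite ltr0n.
have -> : x ^+ m = `|x| ^+ m.
  by rewrite -normrX ger0_norm// /m exprM exprn_ge0 ?sqr_ge0.
have le1 : `|x| * (s * expR 1) <= m%:R * expR (s * `|x| / m%:R).
  have := expR_ge1Dx (s * `|x| / m%:R - 1).
  rewrite addrCA subrr addr0 expRB ler_pdivlMr ?expR_gt0// => h.
  rewrite -ler_pdivrMl//; apply: le_trans h; rewrite le_eqVlt; apply/orP; left.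
  by apply/eqP; field; rewrite gt_eqF.
rewrite -!exprMn; apply: (@le_trans _ _ ((m%:R * expR (s * `|x| / m%:R)) ^+ m)).
  by rewrite lerXn2r// nnegrE !mulr_ge0// ?expR_ge0// ltW.
rewrite exprMn ler_wpM2l ?exprn_ge0//.
rewrite -expRM_natr mulfVK ?gt_eqF//.
have [x0|x0] := leP 0 x.
  by rewrite ger0_norm// lerDl expR_ge0.
by rewrite ltr0_norm// mulrN -mulNr lerDr expR_ge0.
Qed.

(** exp 1 is the square of exp (1/2), which is at least 3/2. *)
Lemma expR1_ge : 9/4 <= expR 1 :> R.
Proof.
have := expR_ge1Dx (2^-1 : R) => h.
rewrite (_ : 1 = 2^-1 * 2%:R :> R) ?expRM_natr ?mulVf//.
rewrite expr2; nra.
Qed.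

(** With m = 9n/10, the tangent inequality for y^(k+1) at m and the exponential
    lower bound for y combine into a pointwise bound by two Gaussians, whose
    integrals are known. Subtraction is avoided by moving the negative terms to
    the other side before integrating. *)
Lemma gauss_moment_ge n k : (0 < n)%N ->
  (((9/10 * n%:R) ^+ k.+1 * sqrt2pi ^+ n)%:E <=
   \int[lebn n]_t (tsq t ^+ k.+1 * gauss t)%:E :> \bar R)%E.
Proof.
move=> n0; have [q [q1 qn]] := gauss_scale_bound n0.
set m := 9/10 * n%:R in qn *.
have m0 : 0 < m by rewrite mulr_gt0 ?ltr0n//; lra.
pose h := q ^+ 2 - 1.
have h0 : 0 < h by rewrite /h subr_gt0 exprn_egt1.
have q0 : 0 < q by lra.
pose A := k.+1%:R * m ^+ k * (2 / h); pose B := k%:R * m ^+ k.+1.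
have A0 : 0 <= A by rewrite !mulr_ge0// ?exprn_ge0 ?invr_ge0// ltW.
have B0 : 0 <= B by rewrite mulr_ge0// exprn_ge0// ltW.
pose gq (t : n.-tuple R) := expR (tdot [tuple 0 | _ < n] t - q ^+ 2 * tsq t / 2).
have dot0 (t : n.-tuple R) : tdot [tuple 0 | _ < n] t = 0.
  by rewrite /tdot big1// => i _; rewrite tnth_mktuple mul0r.
have sq0 : tsq [tuple (0 : R) | _ < n] = 0.
  by rewrite /tsq big1// => i _; rewrite tnth_mktuple expr0n.
have pw t : A * gauss t <= tsq t ^+ k.+1 * gauss t + (A * gq t + B * gauss t).
  have y0 := tsq_ge0 t; set y := tsq t in y0 *.
  have gqE : gq t = expR (- (h * y / 2)) * gauss t.
    rewrite /gq /gauss dot0 -expRD /h -/y; congr expR; by field.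
  rewrite gqE mulrA -!mulrDl ler_pM2r ?gauss_gt0//.
  have e1 := expR_ge1Dx (- (h * y / 2)).
  have e2 : 2 / h * (1 - expR (- (h * y / 2))) <= y.
    rewrite [leLHS]mulrAC ler_pdivrMr//; lra.
  have := tangent_pow k y0 m0; rewrite -/B.
  have c0 : 0 <= k.+1%:R * m ^+ k by rewrite mulr_ge0// exprn_ge0// ltW.
  have := ler_wpM2l c0 e2; rewrite mulrA -/A; lra.
have mg := @measurable_gauss R n.
have mq : measurable_fun [set: n.-tuple GR] gq.
  apply: measurableT_comp => //; apply: measurable_funB; first exact: measurable_tdot.
  apply: measurable_funM => //; apply: measurable_funM => //; exact: measurable_tsq.
have ms : measurable_fun [set: n.-tuple GR] (fun t => tsq t ^+ k.+1 * gauss t).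
  by apply: measurable_funM => //; apply: measurable_funX; exact: measurable_tsq.
have mA (c : R) (f : n.-tuple GR -> R) : measurable_fun setT f ->
    measurable_fun setT (fun t => c * f t).
  by move=> mf; apply: measurable_funM.
have iZ (c : R) (f : n.-tuple GR -> R) : 0 <= c -> measurable_fun setT f ->
    (forall t, 0 <= f t) ->
    (\int[lebn n]_t (c * f t)%:E = c%:E * \int[lebn n]_t (f t)%:E)%E.
  move=> c0 mf f0; under eq_integral do rewrite EFinM.
  by rewrite ge0_integralZl//; [exact/measurable_EFinP|move=> x _; rewrite lee_fin].
have gq0 t : 0 <= gq t by exact: expR_ge0.
have sg0 (t : n.-tuple GR) : 0 <= tsq t ^+ k.+1 * gauss t.
  by rewrite mulr_ge0 ?gauss_ge0// exprn_ge0// tsq_ge0.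
have mE (f : n.-tuple GR -> R) : measurable_fun setT f ->
    measurable_fun setT (fun t => (f t)%:E) by move=> ?; exact/measurable_EFinP.
have mEs := mE _ ms.
have mEA := mE _ (mA A _ mg).
have mEB := mE _ (mA B _ mg).
have mEq := mE _ (mA A _ mq).
have : (\int[lebn n]_t (A * gauss t)%:E <= \int[lebn n]_t
    ((tsq t ^+ k.+1 * gauss t)%:E + ((A * gq t)%:E + (B * gauss t)%:E)))%E.
  apply: ge0_le_integral => //.
  - by move=> t _; rewrite lee_fin mulr_ge0// gauss_ge0.
  - by apply: emeasurable_funD; [|apply: emeasurable_funD].
  - by move=> t _; rewrite -!EFinD lee_fin.
rewrite ge0_integralD//; last 3 first.
- by move=> t _; rewrite lee_fin; exact: sg0.
- by move=> t _; rewrite adde_ge0// lee_fin mulr_ge0// gauss_ge0.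
- by apply: emeasurable_funD.
rewrite ge0_integralD//; last 2 first.
- by move=> t _; rewrite lee_fin mulr_ge0.
- by move=> t _; rewrite lee_fin mulr_ge0// gauss_ge0.
have g0 (t : n.-tuple GR) : 0 <= gauss t by exact: gauss_ge0.
rewrite !iZ//.
rewrite integral_gauss integral_exp_quadratic// sq0 mul0r expR0 mulr1.
rewrite -!EFinM -EFinD -leeBlDr// -EFinB; apply: le_trans.
rewrite lee_fin expr_div_n.
have c0 : 0 <= k.+1%:R * m ^+ k by rewrite mulr_ge0// exprn_ge0// ltW.
have : m ^+ k.+1 + B <= A * (1 - q ^- n).
  rewrite -/h in qn; have := ler_wpM2l c0 qn.
  by rewrite /A /B exprS -natr1; lra.
rewrite -(ler_pM2r (exprn_gt0 n (@sqrt2pi_gt0 R))); lra.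
Qed.

(** The free parameter s of [pow_exp_bound] is chosen as sqrt(2k/v), which
    minimises the resulting bound when |u|^2 = v. *)
Lemma gauss_moment_le n k (u : n.-tuple R) (v : R) : (0 < k)%N -> 0 < v ->
  tsq u <= v ->
  (\int[lebn n]_t (tdot u t ^+ (2 * k) * gauss t)%:E <=
   (2 * expR (- k%:R) * ((2 * k)%:R * v) ^+ k * sqrt2pi ^+ n)%:E :> \bar R)%E.
Proof.
move=> k0 v0 uv; pose s := Num.sqrt ((2 * k)%:R / v).
have kR : 0 < (2 * k)%:R :> R by rewrite ltr0n muln_gt0.
have s2 : s ^+ 2 = (2 * k)%:R / v by rewrite sqr_sqrtr// divr_ge0// ltW.
have s0 : 0 < s by rewrite sqrtr_gt0 divr_gt0.
pose C := ((2 * k)%:R / (s * expR 1)) ^+ (2 * k).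
have se0 : 0 < s * expR 1 by rewrite mulr_gt0// expR_gt0.
have C0 : 0 <= C by rewrite exprn_ge0// divr_ge0// ltW.
have CE : C = ((2 * k)%:R * v) ^+ k * expR (- (k%:R * 2)).
  have -> : (k%:R * 2 : R) = 2 * k%:R by rewrite mulrC.
  rewrite -mulNr expRM_natr -exprMn /C exprM; congr (_ ^+ k).
  have e2 : expR (- 2) = (expR 1 ^+ 2)^-1 :> R by rewrite -expRM_natr mul1r expRN.
  by rewrite e2 expr_div_n exprMn s2; field; rewrite !gt_eqF ?expR_gt0 ?ltr0n.
pose su b : n.-tuple R := [tuple b * s * tnth u i | i < n].
have dsu b t : tdot (su b) t = b * s * tdot u t.
  by rewrite /tdot mulr_sumr; apply: eq_bigr => i _; rewrite tnth_mktuple !mulrA.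
have ssu b : tsq (su b) = b ^+ 2 * s ^+ 2 * tsq u.
  by rewrite /tsq mulr_sumr; apply: eq_bigr => i _; rewrite tnth_mktuple !exprMn.
pose g b (t : n.-tuple R) := expR (tdot (su b) t - 1 ^+ 2 * tsq t / 2).
have mgb b : measurable_fun [set: n.-tuple GR] (g b).
  apply: measurableT_comp => //; apply: measurable_funB; first exact: measurable_tdot.
  apply: measurable_funM => //; apply: measurable_funM => //; exact: measurable_tsq.
have mg b : measurable_fun [set: n.-tuple GR] (fun t => (C * g b t)%:E).
  by apply/measurable_EFinP; exact: measurable_funM.
apply: (@le_trans _ _ (\int[lebn n]_t ((C * g 1 t)%:E + (C * g (-1) t)%:E))%E).
  apply: ge0_le_integral => //.
  - by move=> t _; rewrite lee_fin mulr_ge0 ?gauss_ge0// exprM exprn_ge0// sqr_ge0.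
  - apply/measurable_EFinP; apply: measurable_funM; last exact: measurable_gauss.
    by apply: measurable_funX; exact: measurable_tdot.
  - by apply: emeasurable_funD.
  - move=> t _; rewrite -EFinD lee_fin.
    have gE b : g b t = expR (b * s * tdot u t) * gauss t.
      by rewrite /g dsu /gauss -expRD; congr expR; rewrite expr1n mul1r mulNr.
    rewrite !gE -mulrDr -mulrDl mulrA ler_pM2r ?gauss_gt0//.
    have := pow_exp_bound (tdot u t) k0 s0.
    rewrite -exprMn -ler_pdivlMr ?exprn_gt0// => /le_trans; apply.
    by rewrite mul1r mulN1r /C expr_div_n mulrAC.
rewrite ge0_integralD//; last 2 first.
- by move=> t _; rewrite lee_fin mulr_ge0// expR_ge0.
- by move=> t _; rewrite lee_fin mulr_ge0// expR_ge0.
have ig b : b ^+ 2 = 1 ->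
    (\int[lebn n]_t (C * g b t)%:E <= (C * (sqrt2pi ^+ n * expR k%:R))%:E)%E.
  move=> b2; under eq_integral do rewrite EFinM.
  rewrite ge0_integralZl//; last 2 first.
  - by apply/measurable_EFinP; exact: mgb.
  - by move=> t _; rewrite lee_fin expR_ge0.
  rewrite integral_exp_quadratic// divr1 -EFinM lee_fin ler_wpM2l// ler_wpM2l//.
    by rewrite exprn_ge0// ltW// sqrt2pi_gt0.
  rewrite ler_expR ssu b2 mul1r s2 expr1n mul1r ler_pdivrMr//.
  rewrite natrM mulrC mulrA ler_pdivrMr//. 
  nra.
apply: (le_trans (leeD (ig 1 _) (ig (-1) _))); rewrite ?expr1n ?sqrrN ?expr1n//.
rewrite -EFinD lee_fin CE.
have -> : expR (- (k%:R * 2)) = expR (- k%:R) * expR (- k%:R) :> R.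
  by rewrite -expRD; congr expR; ring.
rewrite le_eqVlt; apply/orP; left; apply/eqP.
transitivity (2 * expR (- k%:R) * ((2 * k)%:R * v) ^+ k * sqrt2pi ^+ n *
    (expR (- k%:R) * expR k%:R)).
  ring.
by rewrite -expRD addNr expR0 mulr1.
Qed.

End Moments.

(** * Rearrangement against a weight *)

Section Rearrangement.
Local Open Scope ereal_scope.
Context d (T : measurableType d) (R : realType).
Variable mu : {sigma_finite_measure set T -> \bar R}.

(** Pointwise (1_A - 1_B) * (phi - tau) <= 0; integrate, and use
    mu A <= mu B < +oo to cancel the terms with tau. Stated for complements, which
    are the superlevel sets of the layer cake formula. *)
Lemma bathtub (phi : T -> R) (tau : R) (A B : set T) :
  measurable_fun [set: T] phi -> (forall x, 0 <= phi x)%R -> (0 <= tau)%R ->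
  measurable A -> measurable B -> mu A <= mu B -> mu B < +oo ->
  (forall x, B x -> (tau <= phi x)%R) -> (forall x, ~ B x -> (phi x <= tau)%R) ->
  \int[mu]_x (\1_(~` B) x * phi x)%:E <= \int[mu]_x (\1_(~` A) x * phi x)%:E.
Proof.
move=> mphi phi0 tau0 mA mB AB Boo Bphi nBphi.
have mi (S : set T) : measurable S -> measurable_fun setT (fun x => (\1_S x * phi x)%:E).
  by move=> mS; apply/measurable_EFinP; apply: measurable_funM => //; exact: measurable_indic.
have mt (S : set T) : measurable S -> measurable_fun setT (fun x => (tau * \1_S x)%:E).
  by move=> mS; apply/measurable_EFinP; apply: measurable_funM => //; exact: measurable_indic.
have it (S : set T) : measurable S -> \int[mu]_x (tau * \1_S x)%:E = tau%:E * mu S.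
  move=> mS; under eq_integral do rewrite EFinM.
  rewrite ge0_integralZl//; last by apply/measurable_EFinP; exact: measurable_indic.
  by rewrite integral_indic// setIT.
have nn (S : set T) x : 0 <= (\1_S x * phi x)%:E by rewrite lee_fin mulr_ge0.
have nt (S : set T) x : 0 <= (tau * \1_S x)%:E by rewrite lee_fin mulr_ge0.
have mAC := measurableC mA; have mBC := measurableC mB.
have : \int[mu]_x ((\1_(~` B) x * phi x)%:E + (tau * \1_B x)%:E) <=
    \int[mu]_x ((\1_(~` A) x * phi x)%:E + (tau * \1_A x)%:E).
  apply: ge0_le_integral => //.
  - by move=> x _; rewrite adde_ge0.
  - by apply: emeasurable_funD; [exact: mi|exact: mt].
  - by apply: emeasurable_funD; [exact: mi|exact: mt].
  - move=> x _; rewrite -!EFinD lee_fin !indicE !in_setC.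
    have [/set_mem Bx|Bx] := boolP (x \in B); have [Ax|Ax] := boolP (x \in A) => /=;
      rewrite ?mul0r ?mul1r ?mulr0 ?mulr1 ?addr0 ?add0r ?lexx//.
    + exact: Bphi.
    + by apply: nBphi => /mem_set; exact/negP.
rewrite ge0_integralD//; [|exact: mi|exact: mt].
rewrite ge0_integralD//; [|exact: mi|exact: mt].
rewrite !it// => h.
have fB : tau%:E * mu B \is a fin_num by rewrite fin_numM// ge0_fin_numE.
rewrite -(leeD2rE _ _ fB); apply: (le_trans h).
by rewrite leeD2l// lee_wpmul2l// lee_fin.
Qed.

(** F x is the length of ]0, F x[; exchange the two integrals. *)
Lemma layer_cake (F phi : T -> R) :
  measurable_fun [set: T] F -> measurable_fun [set: T] phi ->
  (forall x, 0 <= F x)%R -> (forall x, 0 <= phi x)%R ->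
  \int[mu]_x (F x * phi x)%:E =
  \int[lebesgue_measure]_(s in `]0%R, +oo[)
    \int[mu]_x (\1_(~` [set y | (F y <= s)%R]) x * phi x)%:E.
Proof.
move=> mF mphi F0 phi0.
transitivity (\int[mu]_x \int[lebesgue_measure]_s ((\1_`]0%R, F x[ s * phi x)%R)%:E).
  apply: eq_integral => x _.
  under [RHS]eq_integral do rewrite mulrC EFinM.
  rewrite ge0_integralZl//.
  - rewrite integral_indic// setIT EFinM muleC; congr (_ * _).
    transitivity (lebesgue_measure (`]0%R, F x[%classic : set R)); last by [].
    rewrite lebesgue_measure_itv/= lte_fin.
    case: ltP => [_|Fx]; first by rewrite -EFinB subr0.
    by congr (_%:E); apply/eqP; rewrite eq_le Fx F0.
  - by apply/measurable_EFinP; exact: measurable_indic.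
  - by rewrite lee_fin.
pose f (p : T * measurableTypeR R) := ((\1_`]0%R, F p.1[ p.2 * phi p.1)%R)%:E.
transitivity (\int[lebesgue_measure]_s \int[mu]_x f (x, s)).
  apply: (@fubini_tonelli _ _ _ _ _ mu lebesgue_measure f).
  - have mF1 : measurable_fun setT (fun p : T * measurableTypeR R => F p.1).
      exact: measurableT_comp.
    have m2 : measurable_fun setT (fun p : T * measurableTypeR R => p.2 : R).
      exact: measurable_snd.
    apply/measurable_EFinP; apply: measurable_funM; last exact: measurableT_comp.
    pose S := [set p : T * measurableTypeR R | (0 < p.2)%R] `&` [set p | (p.2 < F p.1)%R].
    have -> : (fun p : T * measurableTypeR R => \1_`]0%R, F p.1[ p.2 : R) =
        (\1_S : T * measurableTypeR R -> R).
      apply: funext => p; rewrite !indicE; congr (_%:R)%R; congr nat_of_bool.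
      apply/idP/idP => /set_mem/=; first by rewrite in_itv/= => /andP h; apply/mem_set.
      by move=> [h1 h2]; apply/mem_set; rewrite /= in_itv/=; apply/andP.
    apply: measurable_indic; apply: measurableI; rewrite -[X in measurable X]setTI.
    + exact: (measurable_fun_ltr (measurable_cst (0%R : R)) m2 measurableT (Y := [set true])).
    + exact: (measurable_fun_ltr m2 mF1 measurableT (Y := [set true])).
  - by move=> p; rewrite lee_fin mulr_ge0.
rewrite [RHS]integral_mkcond; apply: eq_integral => s _; rewrite patchE.
have [s0|s0] := ltP 0%R s.
  rewrite mem_set/= ?in_itv/= ?s0//; apply: eq_integral => x _; congr ((_ * _)%R)%:E.
  rewrite !indicE; congr (_%:R)%R; congr nat_of_bool; rewrite in_setC.
  apply/idP/idP => [/set_mem/=|/negP h].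
    by rewrite in_itv/= => /andP[_ sF]; apply/negP => /set_mem/=; rewrite leNgt sF.
  by apply/mem_set => /=; rewrite in_itv/= s0/= ltNge;
    apply/negP => ?; apply: h; apply/mem_set.
rewrite memNset/= ?in_itv/= ?andbT ?leNgt//; last by apply/negP; rewrite -leNgt.
apply: integral0_eq => x _; rewrite /f indicE memNset ?mul0r//= in_itv/= => /andP[s0' _].
by move: s0; rewrite leNgt s0'.
Qed.

(** Only positive levels are compared: at level 0 the sets {F <= 0} of two
    homogeneous functions need not be ordered by volume. *)
Lemma le_layer_cake (F H phi : T -> R) :
  measurable_fun [set: T] F -> measurable_fun [set: T] H -> measurable_fun [set: T] phi ->
  (forall x, 0 <= F x)%R -> (forall x, 0 <= H x)%R -> (forall x, 0 <= phi x)%R ->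
  (forall s, (0 < s)%R ->
    \int[mu]_x (\1_(~` [set y | (F y <= s)%R]) x * phi x)%:E <=
    \int[mu]_x (\1_(~` [set y | (H y <= s)%R]) x * phi x)%:E) ->
  \int[mu]_x (F x * phi x)%:E <= \int[mu]_x (H x * phi x)%:E.
Proof.
move=> mF mH mphi F0 H0 phi0 FH; rewrite !layer_cake//.
rewrite integral_mkcond [leRHS]integral_mkcond.
apply: ge0_le_integral_all => s; rewrite !patchE; case: ifPn => //.
- by move=> _; apply: integral_ge0 => x _; rewrite lee_fin mulr_ge0.
- by move=> /set_mem; rewrite /= in_itv/= andbT; exact: FH.
Qed.

End Rearrangement.

(** * The volume of a sublevel set *)

Section VolumeBound.
Context {R : realType}.
Local Notation GR := (measurableTypeR R).

Lemma tsq_scale n (s : R) (t : n.-tuple GR) : tsq (scale_tuple s t) = s ^+ 2 * tsq t.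
Proof.
by rewrite /tsq mulr_sumr; apply: eq_bigr => i _; rewrite tnth_mktuple exprMn.
Qed.

Lemma tdot_scale n (s : R) (u t : n.-tuple GR) : tdot u (scale_tuple s t) = s * tdot u t.
Proof.
by rewrite /tdot mulr_sumr; apply: eq_bigr => i _; rewrite tnth_mktuple mulrCA.
Qed.

Lemma tdot_le n (u t : n.-tuple R) : `|tdot u t| <= (tsq u + tsq t) / 2.
Proof.
rewrite /tdot /tsq -big_split mulr_suml /=.
apply: (le_trans (ler_norm_sum _ _ _)); apply: ler_sum => i _.
have := sqr_ge0 (tnth u i + tnth t i); have := sqr_ge0 (tnth u i - tnth t i).
by rewrite ler_norml => *; apply/andP; split; nra.
Qed.

Definition sq_ball n (a : R) : set (n.-tuple GR) := [set t | tsq t <= a].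

Arguments sq_ball : clear implicits.

Lemma measurable_sq_ball n (a : R) : measurable (sq_ball n a).
Proof.
rewrite -[X in measurable X]setTI.
exact: (measurable_fun_ler (@measurable_tsq R n) (measurable_cst a)
  measurableT (Y := [set true])).
Qed.

(** The indicator of the ball is at most a multiple of the Gaussian. *)
Lemma lebn_sq_ball_fin n (a : R) : (lebn n (sq_ball n a) < +oo)%E.
Proof.
have mB := @measurable_sq_ball n a.
apply: (@le_lt_trans _ _ (\int[lebn n]_t (expR (a / 2) * gauss t)%:E)%E).
  rewrite -[X in lebn n X]setIT -integral_indic//.
  apply: ge0_le_integral_all => t; first by rewrite lee_fin.
  rewrite lee_fin indicE; case: (boolP (t \in _)) => [/set_mem ta|_].
    by rewrite /gauss -expRD -expR0 ler_expR -mulrDl divr_ge0// subr_ge0.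
  by rewrite mulr_ge0 ?expR_ge0.
under eq_integral do rewrite EFinM.
rewrite ge0_integralZl//.
- by rewrite integral_gauss -EFinM ltry.
- by apply/measurable_EFinP; exact: measurable_gauss.
- by move=> t _; rewrite lee_fin gauss_ge0.
Qed.

Lemma lebn_sq_ball_scale n (s a : R) : 0 < s ->
  lebn n (sq_ball n (s ^+ 2 * a)) = ((s ^+ n)%:E * lebn n (sq_ball n a))%E.
Proof.
move=> s0; have si0 : 0 < s^-1 by rewrite invr_gt0.
rewrite -[in RHS](invrK s) exprVn -(lebn_scale si0); last exact: measurable_sq_ball.
congr (lebn n _); apply/seteqP; split => t; 
  rewrite /sq_ball/= tsq_scale exprVn ler_pdivrMl// ?exprn_gt0//.
Qed.

(** If the unit ball were null, so would be all its dilates, and the Gaussian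
    would integrate to 0. *)
Lemma lebn_sq_ball_gt0 n : (0 < lebn n (sq_ball n 1))%E.
Proof.
rewrite lt_neqAle measure_ge0 andbT; apply/negP => /eqP/esym B0.
have Bk k : lebn n (sq_ball n (k.+1%:R ^+ 2)) = 0%E.
  by rewrite -[_ ^+ 2]mulr1 lebn_sq_ball_scale// B0 mule0.
have T0 : lebn n [set: n.-tuple GR] = 0%E.
  apply/eqP; rewrite eq_le measure_ge0 andbT.
  rewrite -[leRHS](@eseries0 R (fun k => lebn n (sq_ball n (k.+1%:R ^+ 2))) 0 xpredT)//.
  apply: measure_sigma_subadditive => //; first by move=> k; exact: measurable_sq_ball.
  move=> t _; exists (Num.truncn (tsq t)) => //; rewrite /sq_ball/=.
  by rewrite (le_trans (ltW (truncnS_gt (tsq t))))// ler_eXnr// ler1n.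
have := @integral_gauss R n.
rewrite null_set_integral//; last by apply/measurable_EFinP; exact: measurable_gauss.
by move=> [] /esym/eqP; rewrite gt_eqF// exprn_gt0// sqrt2pi_gt0.
Qed.

Section Bound.
Context d (T : measurableType d) (P : probability T R).
Variables (n k : nat) (u : T -> n.-tuple R) (v : R).
Hypotheses (n0 : (0 < n)%N) (v0 : 0 < v).
Hypothesis mu : forall i, measurable_fun [set: T] (fun g => tnth (u g) i).
Hypothesis uv : forall g, tsq (u g) <= v.

Let f (p : n.-tuple GR * T) : \bar R := (tdot (u p.2) p.1 ^+ (2 * k.+1))%:E.

Let f0 p : (0 <= f p)%E.
Proof. by rewrite lee_fin exprM exprn_ge0// sqr_ge0. Qed.

Let mf : measurable_fun setT f.
Proof.
apply/measurable_EFinP; apply: measurable_funX; apply: measurable_sum => i.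
apply: measurable_funM; first exact: (measurableT_comp (mu i)).
exact: (measurableT_comp (@measurable_coord R n i)).
Qed.

Let integral_cstP (c : R) : (\int[P]_(g in setT) c%:E = c%:E)%E.
Proof.
transitivity (c%:E * P setT)%E; first exact: integral_cst.
by rewrite probability_setT mule1.
Qed.

Let mfc c : measurable_fun [set: T] (fun g => f (c, g)).
Proof. by apply: (measurableT_comp mf); exact: pair1_measurable. Qed.

(** The function F described above, for a random vector u; it is a real
    number because the integrand is bounded in g ([avg_powE]). *)
Definition avg_pow (c : n.-tuple GR) : R := fine (\int[P]_g f (c, g))%E.

Lemma avg_powE c : (avg_pow c)%:E = (\int[P]_g f (c, g))%E.
Proof.
rewrite fineK// ge0_fin_numE; last exact: integral_ge0.
apply: (@le_lt_trans _ _ (\int[P]_(g in setT) (((v + tsq c) / 2) ^+ (2 * k.+1))%:E)%E).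
  apply: ge0_le_integral_all => // g; rewrite lee_fin.
  rewrite [leLHS]exprM [leRHS]exprM lerXn2r// ?nnegrE ?sqr_ge0//.
  rewrite -real_normK ?num_real// lerXn2r// ?nnegrE//.
    by rewrite divr_ge0// addr_ge0 ?tsq_ge0// ltW.
  by apply: (le_trans (tdot_le _ _)); rewrite ler_pM2r// lerD2r.
by rewrite integral_cstP ltry.
Qed.

Lemma avg_pow_ge0 c : 0 <= avg_pow c.
Proof. by rewrite -lee_fin avg_powE; exact: integral_ge0. Qed.

Lemma measurable_avg_pow : measurable_fun [set: n.-tuple GR] avg_pow.
Proof.
apply/measurable_EFinP; rewrite (_ : _ \o _ = fubini_F P f).
  exact: measurable_fun_fubini_tonelli_F.
by apply/funext => c /=; rewrite avg_powE.
Qed.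

Lemma avg_pow_scale s c : avg_pow (scale_tuple s c) = s ^+ (2 * k.+1) * avg_pow c.
Proof.
apply: EFin_inj; rewrite EFinM !avg_powE -ge0_integralZl//; last first.
  by rewrite lee_fin exprM exprn_ge0// sqr_ge0.
by apply: eq_integral => g _; rewrite /f /= tdot_scale exprMn EFinM.
Qed.

(** Exchange the integrals and bound the Gaussian moment of each u g. *)
Lemma integral_avg_pow_gauss :
  (\int[lebn n]_c (avg_pow c * gauss c)%:E <=
   (2 * expR (- k.+1%:R) * ((2 * k.+1)%:R * v) ^+ k.+1 * sqrt2pi ^+ n)%:E)%E.
Proof.
pose h (p : n.-tuple GR * T) : \bar R := (f p * (gauss p.1)%:E)%E.
have -> : (\int[lebn n]_c (avg_pow c * gauss c)%:E =
    \int[lebn n]_c \int[P]_g h (c, g))%E.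
  apply: eq_integral => c _.
  rewrite EFinM avg_powE /h /= ge0_integralZr//.
  by rewrite lee_fin gauss_ge0.
have -> : (\int[lebn n]_c \int[P]_g h (c, g) = \int[P]_g \int[lebn n]_c h (c, g))%E.
  apply: (@fubini_tonelli _ _ _ _ _ (lebn n) P h).
  - apply: emeasurable_funM => //; apply/measurable_EFinP.
    exact: (measurableT_comp (@measurable_gauss R n)).
  - by move=> p; rewrite mule_ge0// lee_fin gauss_ge0.
set C := (2 * _ * _ * _).
apply: (@le_trans _ _ (\int[P]_(g in setT) C%:E)%E).
  apply: ge0_le_integral_all => g.
    by apply: integral_ge0 => c _; rewrite mule_ge0// lee_fin gauss_ge0.
  rewrite (_ : (fun c => _) = (fun c => (tdot (u g) c ^+ (2 * k.+1) * gauss c)%:E)).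
    exact: (gauss_moment_le (ltn0Sn k) v0 (uv g)).
  by apply: funext => c; rewrite EFinM.
by rewrite integral_cstP.
Qed.

Lemma measurable_avg_pow_le (s : R) : measurable [set c | avg_pow c <= s].
Proof.
rewrite -[X in measurable X]setTI.
exact: (measurable_fun_ler measurable_avg_pow (measurable_cst s)
  measurableT (Y := [set true])).
Qed.

(** The comparison of K with the ball B described above. *)
Lemma lebn_sq_ball_le_avg_pow :
  (lebn n (sq_ball n (n%:R / ((2 * k.+1)%:R * v))) <=
   lebn n [set c | (avg_pow c <= 1)%R])%E.
Proof.
set a := (2 * k.+1)%:R * v; set r := n%:R / a.
have a0 : 0 < a by rewrite mulr_gt0// ltr0n.
have nR : 0 < n%:R :> R by rewrite ltr0n.
have r0 : 0 < r by rewrite divr_gt0.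
set K := [set c | _]; rewrite leNgt; apply/negP => KB.
pose H (c : n.-tuple GR) := (tsq c / r) ^+ k.+1.
have H0 c : 0 <= H c by rewrite exprn_ge0// divr_ge0 ?tsq_ge0// ltW.
have mH : measurable_fun setT H.
  by apply: measurable_funX; apply: measurable_funM => //; exact: measurable_tsq.
have Hle : (\int[lebn n]_c (H c * gauss c)%:E <=
    \int[lebn n]_c (avg_pow c * gauss c)%:E)%E.
  apply: le_layer_cake => //.
  - exact: measurable_avg_pow.
  - exact: measurable_gauss.
  - exact: avg_pow_ge0.
  - by move=> c; exact: gauss_ge0.
  (* Both sublevel sets at height s are the dilates, by l = s^(1/2k), of those
     at height 1, and tau is the value of the Gaussian on the bounding sphere. *)
  move=> s s0; pose l := s `^ (2 * k.+1)%:R^-1.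
  have l0 : 0 < l by rewrite powR_gt0.
  have ls : l ^+ (2 * k.+1) = s.
    by rewrite -powR_mulrn ?ltW// -powRrM mulVf ?powRr1// ?ltW// pnatr_eq0.
  have HE : [set y | H y <= s] = sq_ball n (l ^+ 2 * r).
    have eqH c : (H c <= s) = (tsq c <= l ^+ 2 * r).
      rewrite /H -ls exprM ler_pXn2r ?nnegrE ?sqr_ge0// ?ler_pdivrMr//.
      by rewrite divr_ge0 ?tsq_ge0// ltW.
    by apply/seteqP; split => c; rewrite /sq_ball/= eqH.
  have AE : [set y | avg_pow y <= s] = [set y | K (scale_tuple l^-1 y)].
    apply/seteqP; split => c; rewrite /K/= avg_pow_scale exprVn ls.
      by rewrite ler_pdivrMl// mulr1.
    by rewrite ler_pdivrMl// mulr1.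
  have mA := measurable_avg_pow_le s; have mK := measurable_avg_pow_le 1.
  have mB := @measurable_sq_ball n (l ^+ 2 * r).
  have li0 : 0 < l^-1 by rewrite invr_gt0.
  apply: (@bathtub _ _ _ _ _ (expR (- (l ^+ 2 * r) / 2))) => //.
  - exact: measurable_gauss.
  - by move=> c; exact: gauss_ge0.
  - by rewrite HE.
  - rewrite HE AE lebn_scale// lebn_sq_ball_scale// exprVn invrK.
    by rewrite lee_wpmul2l ?ltW// lte_fin exprn_gt0.
  - by rewrite HE; exact: lebn_sq_ball_fin.
  - move=> c; rewrite HE /sq_ball/= => h.
    by rewrite /gauss ler_expR ler_pM2r// lerN2.
  - move=> c; rewrite HE /sq_ball/= => /negP; rewrite -ltNge => h.
    by rewrite /gauss ler_expR ler_pM2r// lerN2 ltW.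
have := le_trans Hle integral_avg_pow_gauss.
have -> : (\int[lebn n]_c (H c * gauss c)%:E =
    (r ^- k.+1)%:E * \int[lebn n]_c (tsq c ^+ k.+1 * gauss c)%:E)%E.
  rewrite -ge0_integralZl//.
  - by apply: eq_integral => c _; rewrite -EFinM /H expr_div_n mulrAC mulrC.
  - apply/measurable_EFinP; apply: measurable_funM; last exact: measurable_gauss.
    by apply: measurable_funX; exact: measurable_tsq.
  - by move=> c _; rewrite lee_fin mulr_ge0 ?gauss_ge0// exprn_ge0// tsq_ge0.
  - by rewrite lee_fin invr_ge0 exprn_ge0// ltW.
have ri0 : (0 <= (r ^- k.+1)%:E)%E by rewrite lee_fin invr_ge0 exprn_ge0// ltW.
move=> /(le_trans (lee_wpmul2l ri0 (gauss_moment_ge k n0))).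
rewrite -EFinM lee_fin mulrA ler_pM2r ?exprn_gt0 ?sqrt2pi_gt0//.
rewrite -exprVn -exprMn.
have -> : r^-1 * (9 / 10 * n%:R) = 9/10 * a.
  by rewrite /r; field; rewrite !gt_eqF.
rewrite exprMn ler_pM2r ?exprn_gt0//; apply/negP; rewrite -ltNge.
rewrite expRN ltr_pdivrMr ?expR_gt0// -[k.+1%:R]mul1r expRM_natr -exprMn.
have e1 := @expR1_ge R.
have e2 : 2 < 9/10 * expR 1 :> R by lra.
rewrite (lt_le_trans e2)// ler_eXnr//; lra.
Qed.

End Bound.
End VolumeBound.
Arguments sq_ball {R} n a.

(** * Coordinates, and measurability along the orbit *)

Section InnerProductFacts.
Context (R : realType) (V : vectType R) (ip : {dot V for idfun}).

Lemma ip_sym (x y : V) : ip x y = ip y x.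
Proof. by rewrite hermC expr0 mul1r. Qed.

Lemma ip_ge0 (x : V) : 0 <= ip x x.
Proof.
have [->|x0] := eqVneq x 0; first by rewrite linear0r.
by rewrite ltW// neq0_dnorm_gt0.
Qed.

Lemma ip_sub (x y : V) : ip (x - y) (x - y) = ip x x - 2 * ip x y + ip y y.
Proof. by rewrite linearBl !linearBr /= (ip_sym y x); ring. Qed.

Lemma ip_add (x y : V) : ip (x + y) (x + y) = ip x x + 2 * ip x y + ip y y.
Proof. by rewrite linearDl !linearDr /= (ip_sym y x); ring. Qed.

Lemma ip_le (x y : V) : `|ip x y| <= (ip x x + ip y y) / 2.
Proof.
have := ip_ge0 (x - y); have := ip_ge0 (x + y); rewrite ip_sub ip_add => *.
by rewrite ler_norml; apply/andP; split; lra.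
Qed.

(** A form of the Cauchy-Schwarz inequality that needs no case distinction on
    w = 0: expand the square of (|w|^2 + 1) y - <w,y> w. *)
Lemma ip_sqr_le (w y : V) : ip w y ^+ 2 <= (ip w w + 1) * ip y y.
Proof.
have := ip_ge0 ((ip w w + 1) *: y - ip w y *: w).
rewrite ip_sub !linearZl_LR !linearZr_LR /GRing.scale/= (ip_sym y w).
have := ip_ge0 w; have := sqr_ge0 (ip w y); set M := ip w w; set s := ip w y => *.
have M1 : 0 < M + 1 by lra.
rewrite -(ler_pM2l M1); nra.
Qed.

Definition comb n (b : n.-tuple V) (c : n.-tuple R) : V :=
  \sum_i tnth c i *: tnth b i.

Definition coords n (b : n.-tuple V) (y : V) : n.-tuple R :=
  [tuple ip (tnth b i) y | i < n].

Lemma ip_comb n (b : n.-tuple V) c y : ip (comb b c) y = tdot (coords b y) c.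
Proof.
rewrite ip_sym /comb linear_sumr /tdot; apply: eq_bigr => i _.
by rewrite linearZr_LR /GRing.scale/= tnth_mktuple mulrC (ip_sym y).
Qed.

Lemma ip_comb_comb n (b : n.-tuple V) c : orthonormal_system ip b ->
  ip (comb b c) (comb b c) = tsq c.
Proof.
move=> bo; rewrite ip_comb /tdot /tsq; apply: eq_bigr => i _.
rewrite tnth_mktuple ip_sym ip_comb /tdot (bigD1 i)//= big1 => [|j ji].
  by rewrite tnth_mktuple bo eqxx mul1r addr0 expr2.
by rewrite tnth_mktuple bo (negbTE ji) mul0r.
Qed.

(** The square of the distance from y to its projection is nonnegative. *)
Lemma bessel n (b : n.-tuple V) y : orthonormal_system ip b ->
  tsq (coords b y) <= ip y y.
Proof.
move=> bo; have := ip_ge0 (comb b (coords b y) - y).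
rewrite ip_sub ip_comb_comb// ip_comb.
have -> : tdot (coords b y) (coords b y) = tsq (coords b y).
  by apply: eq_bigr => i _; rewrite expr2.
lra.
Qed.

End InnerProductFacts.

Section OrbitMeasurable.
Context (R : realType) (G : topologicalGroupType) (V : vectType R).
Context (ip : {dot V for idfun}) (rho : G -> 'End(V)).
Hypothesis rho_action : continuous_linear_action ip rho.

Lemma continuous_ip_orbit (w v : V) : continuous (fun g : G => ip w (rho g v)).
Proof.
move=> g0; apply/cvgrPdist_lt => e e0.
pose M := ip w w + 1.
have M0 : 0 < M by rewrite ltr_wpDl// ip_ge0.
have e'0 : 0 < e / M by rewrite divr_gt0.
have [d d0 near_g0] := action_continuous rho_action g0 v e'0.
near=> g.
have : ipnorm ip (rho g v - rho g0 v) < e / M.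
  have /= := near near_g0 g; apply => //; last first.
    by rewrite subrr /ipnorm linear0r sqrtr0.
rewrite distrC -linearBr /= => h.
rewrite -(@ltr_pXn2r _ 2)// ?nnegrE ?normr_ge0// ?(ltW e0)// real_normK ?num_real//.
apply: (le_lt_trans (ip_sqr_le ip _ _)); rewrite -/M.
have yy : ip (rho g v - rho g0 v) (rho g v - rho g0 v) < (e / M) ^+ 2.
  rewrite -[ltLHS]sqr_sqrtr ?ip_ge0// ltr_pXn2r// nnegrE ?sqrtr_ge0//.
  by rewrite divr_ge0// ltW.
rewrite mulrC -ltr_pdivlMr//; apply: (lt_le_trans yy).
rewrite expr_div_n ler_pM2l ?exprn_gt0// lef_pV2 ?posrE ?exprn_gt0//.
by rewrite ler_eXnr// /M lerDr ip_ge0.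
Unshelve. all: by end_near. Qed.

(** The Borel sets of G are generated by its open sets, and preimages of open
    intervals are open. *)
Lemma measurable_ip_orbit (w v : V) :
  measurable_fun [set: borel G] (fun g : borel G => ip w (rho g v)).
Proof.
apply: (measurability _ (RGenOpens.measurableE R)) => _ [_ [a [b ->]] <-].
rewrite setTI; apply: sub_sigma_algebra => /=.
by apply: open_comp; [move=> g _; exact: continuous_ip_orbit|exact: interval_open].
Qed.

End OrbitMeasurable.

(** * The theorem *)

(** The case A = +oo is included, where the quotient and its root are +oo. *)
Lemma root_lower_bound (R : realType) (n : nat) (r : R) (A B : \bar R) :
  (0 < n)%N -> 0 <= r -> (0 < B)%E -> (B < +oo)%E ->
  ((r ^+ n)%:E * B <= A)%E -> (r%:E <= (A / B) `^ n%:R^-1)%E.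
Proof.
move=> n0 r0; case: B => [B| |]//; rewrite lte_fin => B0 _ H.
have rn0 : 0 <= r ^+ n by rewrite exprn_ge0.
have -> : r%:E = ((r ^+ n)%:E `^ n%:R^-1)%E.
  by rewrite poweR_EFin -powR_mulrn// -powRrM mulfV ?powRr1// pnatr_eq0 -lt0n.
apply: gt0_ler_poweR.
- by rewrite invr_ge0.
- by rewrite in_itv/= leey andbT lee_fin.
- rewrite in_itv/= leey andbT mule_ge0//; last by rewrite inve_ge0 lee_fin ltW.
  by apply: le_trans H; rewrite mule_ge0// lee_fin// ltW.
- rewrite inver gt_eqF//.
  apply: (@le_trans _ _ (((r ^+ n)%:E * B%:E) * (B^-1)%:E)%E).
    by rewrite -!EFinM lee_fin mulfK ?gt_eqF.
  by rewrite lee_wpmul2r// lee_fin invr_ge0 ltW.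
Qed.

Unset Implicit Arguments.

Theorem theorem1p1 (R : realType) (G : topologicalGroupType)
    (G_compact : compact [set: G])
    (mu : probability (borel G) R) (mu_haar : haar_probability mu)
    (V : vectType R) (ip : {dot V for idfun}) (rho : G -> 'End(V))
    (rho_action : continuous_linear_action ip rho)
    (rho_ip : invariant_ip ip rho)
    (v : V) (v_span : affine_hull (group_orbit rho v) = [set: V])
    (k : nat) (k_gt0 : (0 < k)%N) (alpha : R) (alpha_gt0 : 0 < alpha)
    (norm_le : forall l : {scalar V},
      normoo rho v l <= alpha * norm2k rho mu k v l)
    (W : {vspace V}) (W_neq0 : W != 0%VS) :
  (((vol ip W (dual_body_section ip rho W v) / vol ip W (unit_ball ip W))
      `^ (\dim W)%:R^-1)
   >= (alpha^-1 * Num.sqrt ((\dim W)%:R / ((2 * k)%:R * ip v v)))%:E)%E.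
Proof.
have n0 : (0 < \dim W)%N by rewrite lt0n dimv_eq0.
have [vv0|vv0] := eqVneq (ip v v) 0.
  (* the right-hand side is 0, the inverse of 0 being 0 *)
  by rewrite vv0 mulr0 invr0 mulr0 sqrtr0 mulr0 poweR_ge0.
have {vv0} vv : 0 < ip v v by rewrite lt_neqAle eq_sym vv0 ip_ge0.
case: k k_gt0 norm_le => // k _ norm_le.
have [bW bo] : basis_of W (orthonormal_basis ip W) /\
  orthonormal_system ip (orthonormal_basis ip W)
  by exact: (svalP (cid (exists_orthonormal_basis ip W))).
rewrite /vol; set b := orthonormal_basis ip W in bW bo *.
have combW c : comb b c \in W.
  by apply: rpred_sum => i _; rewrite rpredZ// (basis_mem bW)// mem_tnth.
have -> : lebesgue_tuple [set c : (\dim W).-tuple R |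
    unit_ball ip W (\sum_i tnth c i *: tnth b i)] = lebn (\dim W) (sq_ball (\dim W) 1).
  rewrite -lebesgue_tupleE; last exact: measurable_sq_ball.
  congr lebesgue_tuple; apply/seteqP; split => c;
    rewrite /unit_ball/sq_ball/= -/(comb b c) ip_comb_comb//.
  by case.
(* The factor alpha is absorbed into the vectors: [avg_pow] of u is the
   function F. *)
pose u (g : borel G) : (\dim W).-tuple R :=
  [tuple alpha * ip (tnth b i) (rho g v) | i < \dim W].
have meas_u i : measurable_fun [set: borel G] (fun g => tnth (u g) i).
  rewrite (_ : (fun g => _) = (fun g : borel G => alpha * ip (tnth b i) (rho g v))).
    by apply: measurable_funM => //; exact: measurable_ip_orbit.
  by apply: funext => g; rewrite tnth_mktuple.
have uE g : u g = scale_tuple alpha (coords ip b (rho g v)).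
  by apply: eq_from_tnth => i; rewrite !tnth_mktuple.
have sq_u g : tsq (u g) <= alpha ^+ 2 * ip v v.
  by rewrite uE tsq_scale ler_pM2l ?exprn_gt0// -(rho_ip g v v); exact: bessel.
have dot_u g c : tdot (u g) c = alpha * ip (comb b c) (rho g v).
  rewrite ip_comb /tdot mulr_sumr; apply: eq_bigr => i _.
  by rewrite !tnth_mktuple mulrA.
have v0 : 0 < alpha ^+ 2 * ip v v by rewrite mulr_gt0// exprn_gt0.
set rr := alpha^-1 * _.
have rr0 : 0 < rr.
  by rewrite mulr_gt0 ?invr_gt0// sqrtr_gt0 divr_gt0 ?ltr0n// mulr_gt0// ltr0n.
have rrE : rr ^+ 2 = (\dim W)%:R / ((2 * k.+1)%:R * (alpha ^+ 2 * ip v v)).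
  rewrite /rr exprMn sqr_sqrtr ?divr_ge0 ?mulr_ge0 ?ip_ge0//.
  by field; rewrite !gt_eqF// ltr0n.
apply: root_lower_bound => //; [exact: ltW|exact: lebn_sq_ball_gt0|exact: lebn_sq_ball_fin|].
rewrite -lebn_sq_ball_scale// mulr1 rrE.
apply: (le_trans (@lebn_sq_ball_le_avg_pow _ _ _ mu _ k u _ n0 v0 meas_u sq_u)).
rewrite -lebesgue_tupleE; last exact: (measurable_avg_pow_le mu k v0 meas_u sq_u 1).
apply: le_lebesgue_tuple => c /= Fc; rewrite -/(comb b c); split; last exact: combW.
move=> g; set w := comb b c in dot_u *.
pose l : {scalar V} := ip w.
have l_le h : `|l (rho h v)| <= (ip w w + ip v v) / 2.
  by rewrite -(rho_ip h v v); exact: ip_le.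
apply: (le_trans (ler_norm _)).
apply: (@le_trans _ _ (normoo rho v l)).
  apply: ub_le_sup; last by exists g.
  by exists ((ip w w + ip v v) / 2) => _ [h _ <-].
apply: (le_trans (norm_le l)); rewrite /norm2k.
set I := Rintegral _ _ _.
have I0 : 0 <= I by apply: Rintegral_ge0 => h _; rewrite exprM exprn_ge0// sqr_ge0.
(* [avg_pow] is finite, so no information is lost in the [fine] of I. *)
have {}Fc : alpha ^+ (2 * k.+1) * I <= 1.
  suff -> : I = alpha ^- (2 * k.+1) * avg_pow mu k u c.
    by rewrite mulrA mulfV ?mul1r// expf_neq0// gt_eqF.
  have lE h : (l (rho h v) ^+ (2 * k.+1))%:E =
      ((alpha ^- (2 * k.+1))%:E * (tdot (u h) c ^+ (2 * k.+1))%:E)%E.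
    by rewrite -EFinM dot_u exprMn mulrA mulVf ?mul1r// expf_neq0// gt_eqF.
  rewrite /I /Rintegral; under eq_integral do rewrite lE.
  rewrite ge0_integralZl//.
  - by rewrite -(avg_powE mu k v0 sq_u) -EFinM.
  - apply/measurable_EFinP; apply: measurable_funX.
    under eq_fun do rewrite dot_u.
    by apply: measurable_funM => //; exact: measurable_ip_orbit.
  - by move=> h _; rewrite lee_fin exprM exprn_ge0// sqr_ge0.
  - by rewrite lee_fin invr_ge0 exprn_ge0// ltW.
have a0 := ltW alpha_gt0.
have aE : alpha = (alpha ^+ (2 * k.+1)) `^ (2 * k.+1)%:R^-1.
  by rewrite -powR_mulrn// -powRrM mulfV ?powRr1// pnatr_eq0.
rewrite aE -powRM ?exprn_ge0//.
have one : (1 : R) = 1 `^ (2 * k.+1)%:R^-1 by rewrite powR1.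
rewrite [leRHS]one ge0_ler_powR// ?nnegrE//.
by rewrite mulr_ge0// exprn_ge0.
Qed.
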